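(* Let $D_1$ and $D_2$ be bivariate Archimedean copulas with inverse generators $\psi_1$ and $\psi_2$, respectively. Then the following statements hold true. (i) $D_1\leq_{lo}D_2$ if and only if $\psi_1^{-1}\circ\psi_2$ is subadditive. (ii) If $-\psi_1'$ and $-\psi_2'$ are log-convex (on the positive real line), then subadditivity of $\psi_1^{-1}\circ\psi_2$ is equivalent to $D_1\leq_{\partial S}D_2$. (iii) If $-\psi_1'$ and $-\psi_2'$ are log-concave (on the positive real line), then subadditivity of $\psi_1^{-1}\circ\psi_2$ is equivalent to $D_1\geq_{\partial S}D_2$.
   Context: A bivariate copula is a function $C:[0,1]^2\to[0,1]$ that is grounded, $2$-increasing and has uniform marginals. $\partial_i$ denotes the partial derivative with respect to the $i$th component (defined almost everywhere in that component). Archimedean copula: let $\varphi:[0,1]\to[0,\infty]$ be continuous, strictly decreasing and convex with $\varphi(1)=0$ (the generator), and let $\psi:[0,\infty]\to[0,1]$ be its pseudo-inverse, $\psi(t)=\varphi^{-1}(t)$ for $0\leq t\leq\varphi(0)$ and $\psi(t)=0$ for $\varphi(0)<t\leq\infty$ (the inverse generator). The Archimedean copula is $C_\varphi(u,v)=\psi(\varphi(u)+\varphi(v))$. For the inverse generator $\psi_1$ with generator $\varphi_1$, the expression $\psi_1^{-1}$ means the generator $\varphi_1$, so $\psi_1^{-1}\circ\psi_2=\varphi_1\circ\psi_2$, considered as a function on $[0,\infty)$ (the value $\infty$ being possible). A function $f$ on $[0,\infty)$ with non-negative values is subadditive if $f(x+y)\leq f(x)+f(y)$ for all $x,y\in[0,\infty)$.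 In (ii) and (iii) the inverse generators are assumed smooth enough (differentiable on $(0,\infty)$) for $\psi_1',\psi_2'$ to be defined. A non-negative function $f$ on $(0,\infty)$ is log-convex (log-concave) if $f(sx+(1-s)y)\leq f(x)^sf(y)^{1-s}$ (respectively $\geq$) for all $x,y>0$, $s\in(0,1)$. Lower orthant order: $D\leq_{lo}E$ means $D(u,v)\leq E(u,v)$ for all $(u,v)\in[0,1]^2$. Schur order for functions: for an integrable $h:(0,1)\to\mathbb{R}$, let $h^*$ denote its decreasing rearrangement, i.e. the essentially unique decreasing function with $\lambda(h^*\geq w)=\lambda(h\geq w)$ for all $w\in\mathbb{R}$, where $\lambda$ is Lebesgue measure on $(0,1)$. For integrable $f,g:(0,1)\to\mathbb{R}$, write $f\prec_S g$ if $\int_0^x f^*(t)\,dt\leq\int_0^x g^*(t)\,dt$ for all $x\in(0,1)$ and $\int_0^1 f^*(t)\,dt=\int_0^1 g^*(t)\,dt$. Schur order for copula derivatives: $D\leq_{\partial_1 S}E$ if $\partial_1 D(\cdot,v)\prec_S\partial_1E(\cdot,v)$ for all $v\in(0,1)$; $D\leq_{\partial_2 S}E$ if $\partial_2 D(v,\cdot)\prec_S\partial_2E(v,\cdot)$ for all $v\in(0,1)$; $D\leq_{\partial S}E$ if both hold; $D\geq_{\partial S}E$ means $E\leq_{\partial S}D$. *)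

(* Defs.v *)
From HB Require Import structures.
From mathcomp Require Import all_boot all_order all_algebra.
From mathcomp Require Import all_classical all_reals all_analysis.

Set Implicit Arguments.
Unset Strict Implicit.
Unset Printing Implicit Defensive.

Import Order.TTheory GRing.Theory Num.Theory.
Import numFieldNormedType.Exports.

Local Open Scope classical_set_scope.
Local Open Scope ring_scope.

(* Functions on [0, 1], (0, 1) or [0, oo) are total functions on R (or \bar R)
   of which only the values on the stated domain are ever constrained or
   used. *)

Record copula (R : realType) (C : R -> R -> R) : Prop := Copula {
  copula_range : forall u v : R, u \in `[0, 1] -> v \in `[0, 1] ->
    C u v \in `[0, 1];
  copula_grounded : forall u : R, u \in `[0, 1] -> C u 0 = 0 /\ C 0 u = 0;
  copula_margins : forall u : R, u \in `[0, 1] -> C u 1 = u /\ C 1 u = u;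
  copula_2increasing : forall u1 u2 v1 v2 : R,
    u1 \in `[0, 1] -> u2 \in `[0, 1] -> v1 \in `[0, 1] -> v2 \in `[0, 1] ->
    u1 <= u2 -> v1 <= v2 ->
    0 <= C u2 v2 - C u2 v1 - C u1 v2 + C u1 v1
}.

(* The value phi 0 = +oo is allowed; strict monotonicity makes phi finite on
   (0, 1]. In generator_convex, 0 * +oo = 0. *)
Record generator (R : realType) (phi : R -> \bar R) : Prop := Generator {
  generator_ge0 : forall u : R, u \in `[0, 1] -> (0 <= phi u)%E;
  generator_continuous : {within `[0, 1], continuous phi};
  generator_decreasing : forall u v : R, u \in `[0, 1] -> v \in `[0, 1] ->
    u < v -> (phi v < phi u)%E;
  generator_convex : forall u v s : R,
    u \in `[0, 1] -> v \in `[0, 1] -> s \in `[0, 1] ->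
    (phi (s * u + (1 - s) * v)%R <= s%:E * phi u + (1 - s)%R%:E * phi v)%E;
  generator1 : phi 1 = 0%E
}.

(* The [xget] is phi^-1 t: when 0 <= t <= phi 0 there is exactly one u in
   [0, 1] with phi u = t. *)
Definition inverse_generator (R : realType) (phi : R -> \bar R)
    (t : \bar R) : R :=
  if (t <= phi 0%R)%E then xget 0 [set u : R | u \in `[0, 1] /\ phi u = t]
  else 0.

Record archimedean_copula (R : realType) (phi : R -> \bar R)
    (D : R -> R -> R) : Prop := ArchimedeanCopula {
  archimedean_is_copula : copula D;
  archimedean_generator : generator phi;
  archimedeanE : forall u v : R, u \in `[0, 1] -> v \in `[0, 1] ->
    D u v = inverse_generator phi (phi u + phi v)%E
}.

Definition subadditive_nneg (R : realType) (f : R -> \bar R) : Prop :=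
  forall x y : R, 0 <= x -> 0 <= y -> (f (x + y)%R <= f x + f y)%E.

Definition differentiable_pos (R : realType) (f : R -> R) : Prop :=
  forall t : R, 0 < t -> derivable f t 1.

Definition log_convex (R : realType) (f : R -> R) : Prop :=
  (forall x : R, 0 < x -> 0 <= f x) /\
  forall x y s : R, 0 < x -> 0 < y -> 0 < s < 1 ->
    f (s * x + (1 - s) * y) <= f x `^ s * f y `^ (1 - s).

Definition log_concave (R : realType) (f : R -> R) : Prop :=
  (forall x : R, 0 < x -> 0 <= f x) /\
  forall x y s : R, 0 < x -> 0 < y -> 0 < s < 1 ->
    f x `^ s * f y `^ (1 - s) <= f (s * x + (1 - s) * y).

Definition lower_orthant_le (R : realType) (D E : R -> R -> R) : Prop :=
  forall u v : R, u \in `[0, 1] -> v \in `[0, 1] -> D u v <= E u v.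

Definition decreasing_rearrangement (R : realType) (h hs : R -> R) : Prop :=
  (forall x y : R, x \in `]0, 1[ -> y \in `]0, 1[ -> x <= y -> hs y <= hs x) /\
  forall w : R,
    lebesgue_measure [set x : R | (x \in `]0, 1[) /\ w <= hs x] =
    lebesgue_measure [set x : R | (x \in `]0, 1[) /\ w <= h x].

(* Decreasing rearrangements of integrable functions exist and are unique up
   to null sets, so the choice of fs and gs is immaterial. *)
Definition schur_le (R : realType) (f g : R -> R) : Prop :=
  [/\ lebesgue_measure.-integrable `]0, 1[%classic (EFin \o f),
      lebesgue_measure.-integrable `]0, 1[%classic (EFin \o g) &
      exists fs gs : R -> R,
        [/\ decreasing_rearrangement f fs,
            decreasing_rearrangement g gs,
            forall x : R, x \in `]0, 1[ ->
              (\int[lebesgue_measure]_(t in `]0%R, x[) (fs t)%:E <=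
               \int[lebesgue_measure]_(t in `]0%R, x[) (gs t)%:E)%E &
            (\int[lebesgue_measure]_(t in `]0%R, 1%R[) (fs t)%:E =
             \int[lebesgue_measure]_(t in `]0%R, 1%R[) (gs t)%:E)%E]].

(* [derive1] has a constant default value where the derivative does not exist;
   for copulas this only concerns a null set of arguments. *)
Definition partial1 (R : realType) (C : R -> R -> R) (u v : R) : R :=
  derive1 (fun x => C x v) u.

Definition partial2 (R : realType) (C : R -> R -> R) (u v : R) : R :=
  derive1 (fun y => C u y) v.

Definition partial1_schur_le (R : realType) (D E : R -> R -> R) : Prop :=
  forall v : R, v \in `]0, 1[ ->
    schur_le (fun u => partial1 D u v) (fun u => partial1 E u v).

Definition partial2_schur_le (R : realType) (D E : R -> R -> R) : Prop :=
  forall v : R, v \in `]0, 1[ ->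
    schur_le (fun u => partial2 D v u) (fun u => partial2 E v u).

Definition partial_schur_le (R : realType) (D E : R -> R -> R) : Prop :=
  partial1_schur_le D E /\ partial2_schur_le D E.

Definition partial_schur_ge (R : realType) (D E : R -> R -> R) : Prop :=
  partial_schur_le E D.

(* Main.v *)
(** Writing u = psi2 x, v = psi2 y and applying the decreasing maps phi1, psi1
    turns D1 <= D2 into subadditivity of phi1 \o psi2, and back.

    For the Schur orders, differentiate the section of an Archimedean copula:
    with g = - psi', d/du D(u, v) = g (phi u + phi v) / g (phi u). Since
    a + s and b are complementary convex combinations of a and b + s,
    log-convexity of g gives g (a + s) g b <= g a g (b + s), so the derivative
    decreases in u and is its own decreasing rearrangement; its integral over
    (0, x) is D(x, v), and the Schur order is the lower orthant order. If g is
    log-concave the derivative increases, its rearrangement is its reflection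
    at 1/2 with integral v - D(1 - x, v), and the order is reversed. *)

Require Import Defs.
From HB Require Import structures.
From mathcomp Require Import all_boot all_order all_algebra.
From mathcomp Require Import all_classical all_reals all_analysis.
From mathcomp Require Import measurable_realfun ring lra.

Set Implicit Arguments.
Unset Strict Implicit.
Unset Printing Implicit Defensive.

Import Order.TTheory GRing.Theory Num.Theory.
Import numFieldNormedType.Exports.

Local Open Scope classical_set_scope.
Local Open Scope ring_scope.

(** * Integrals of decreasing rearrangements *)

(* Halving [x, y] halves the bound, since the values of k telescope. *)
Lemma eq_endpoints_of_increments (R : realType) (E k : R -> R) (a b : R) :
  a <= b ->
  (forall x y : R, a <= x -> x <= y -> y <= b ->
    `|E y - E x| <= (k x - k y) * (y - x)) ->
  E a = E b.
Proof.
move=> ab H.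
have halve n : forall x y : R, a <= x -> x <= y -> y <= b ->
    `|E y - E x| <= (k x - k y) * (y - x) / 2 ^+ n.
  elim: n => [|n IH] x y ax xy yb; first by rewrite expr0 divr1; exact: H.
  set m := (x + y) / 2.
  have xm : x <= m by rewrite /m; lra.
  have my : m <= y by rewrite /m; lra.
  have H1 := IH x m ax xm (le_trans my yb).
  have H2 := IH m y (le_trans ax xm) my yb.
  have -> : E y - E x = (E y - E m) + (E m - E x) by ring.
  apply: le_trans (ler_normD _ _) _; apply: le_trans (lerD H2 H1) _.
  rewrite exprS invfM /m le_eqVlt; apply/orP; left; apply/eqP.
  by have p2 : (2 : R) ^+ n != 0 by []; field.
apply/eqP; rewrite eq_sym -subr_eq0 -normr_le0; apply/ler_addgt0Pr => e e0.
rewrite add0r.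
set c := (k a - k b) * (b - a).
have c0 : 0 <= c by exact: le_trans (normr_ge0 _) (H _ _ (lexx a) ab (lexx b)).
have [n hn] : exists n : nat, c / e < 2 ^+ n.
  exists (Num.bound (c / e)); apply: lt_trans (archi_boundP _) _.
    by rewrite divr_ge0// ltW.
  by rewrite -natrX ltr_nat ltn_expl.
apply: le_trans (halve n a b (lexx a) ab (lexx b)) _.
by rewrite -/c ler_pdivrMr ?exprn_gt0// mulrC -ler_pdivrMr// ltW.
Qed.

(** A monotone function is measurable, and between [a] and [b] it is bounded by the larger of
    [|k a|] and [|k b|]. The booleans cover open and closed endpoints at once. *)
Lemma nonincreasing_itv_integrable (R : realType) (k : R -> R) (i j : bool) (a b : R) :
  nonincreasing_fun k ->
  lebesgue_measure.-integrable [set` Interval (BSide i a) (BSide j b)]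
    (EFin \o k).
Proof.
move=> kd; apply: measurable_bounded_integrable => //.
- rewrite /= lebesgue_measure_itv; case: ifP => _ /=; exact: ltry.
- exact: nonincreasing_measurable.
- exists (Num.max `|k a| `|k b|); split; first exact: num_real.
  move=> M hM t /=; rewrite itv_boundlr => /andP[at_ tb].
  have {}at_ : a <= t by move: at_; case: i; rewrite bnd_simp // => /ltW.
  have {}tb : t <= b by move: tb; case: j; rewrite bnd_simp // => /ltW.
  apply: le_trans (ltW hM); rewrite ler_norml le_max.
  have := kd _ _ at_; have := kd _ _ tb => h1 h2.
  apply/andP; split.
    have := ler_norm (- k b); rewrite normrN => h3.
    have : `|k b| <= Num.max `|k a| `|k b| by rewrite le_max lexx orbT.
    lra.
  by rewrite (le_trans h2 (ler_norm _)).
Qed.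

Lemma nonincreasing_integral_increment (R : realType) (k : R -> R) (x y : R) :
  nonincreasing_fun k -> 0 <= x -> x <= y ->
  k y * (y - x) <=
  \int[lebesgue_measure]_(t in `]0, y[) k t -
  \int[lebesgue_measure]_(t in `]0, x[) k t <= k x * (y - x).
Proof.
move=> kd x0; rewrite le_eqVlt => /predU1P[<-|xy].
  by rewrite !subrr !mulr0 lexx.
have ik := nonincreasing_itv_integrable _ _ _ _ kd.
have mu_xy : fine (lebesgue_measure `]x, y[%classic : \bar R) = y - x.
  by rewrite lebesgue_measure_itv/= lte_fin xy.
have cst_int (c : R) : lebesgue_measure.-integrable `]x, y[%classic (EFin \o cst c).
  by apply: nonincreasing_itv_integrable => s t _.
(* Adding the null point [x] to the smaller interval makes the difference an integral over []x, y[],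
   which is then compared with constants. *)
rewrite (Rintegral_itv_bndo_bndc (ik false true 0 x)).
rewrite Rintegral_itvB ?bnd_simp//.
rewrite -mu_xy -!Rintegral_cst//.
apply/andP; split; apply: le_Rintegral => //; try exact: cst_int; try exact: ik;
  by move=> t /=; rewrite in_itv/= => /andP[/ltW xt /ltW ty]; exact: kd.
Qed.

(** A fundamental theorem of calculus without continuity: [k] and [g] interlace, so the integral of
    [k] and [G] have nearly equal increments, with an error that telescopes. *)
Lemma nonincreasing_integral_eq (R : realType) (k g G : R -> R) :
  nonincreasing_fun k ->
  (forall x y : R, 0 <= x -> x < y -> y <= 1 -> k y <= g x /\ g y <= k x) ->
  (forall x y : R, 0 <= x -> x < y -> y <= 1 ->
    g y * (y - x) <= G y - G x <= g x * (y - x)) ->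
  forall x : R, 0 <= x -> x <= 1 ->
  \int[lebesgue_measure]_(t in `]0, x[) k t = G x - G 0.
Proof.
move=> kd kg GE x x0 x1.
pose I y := \int[lebesgue_measure]_(t in `]0, y[) k t.
suff : I 0 - G 0 = I x - G x.
  have -> : I 0 = 0 by rewrite /I set_itvoo0 Rintegral_set0.
  by rewrite -/(I x) => ?; lra.
(* On [[a, b]] the average slopes lie in [[k b, k a]] and [[g b, g a]]. By the crossed inequalities
   they differ by at most the drop of [k \+ g]. *)
apply: (@eq_endpoints_of_increments _ (fun y => I y - G y) (k \+ g) 0 x) => //.
move=> a b a0; rewrite le_eqVlt => /predU1P[<- _|ab bx].
  by rewrite !subrr normr0 mulr0.
have b1 : b <= 1 by exact: le_trans x1.
have /andP[I1 I2] := nonincreasing_integral_increment kd a0 (ltW ab).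
rewrite -/(I b) -/(I a) in I1 I2.
have /andP[G1 G2] := GE _ _ a0 ab b1.
have [kg1 kg2] := kg _ _ a0 ab b1.
have d0 : 0 <= b - a by lra.
have := ler_wpM2r d0 kg1; have := ler_wpM2r d0 kg2.
rewrite ler_norml /= => ? ?; apply/andP; split; lra.
Qed.

(* The values 1 and 0 outside (0, 1) keep a decreasing [0, 1]-valued function
   decreasing on the whole line. *)
Definition clamp01 (R : realType) (f : R -> R) (x : R) : R :=
  if x <= 0 then 1 else if x < 1 then f x else 0.

Lemma clamp01_in (R : realType) (f : R -> R) (x : R) :
  x \in `]0, 1[ -> clamp01 f x = f x.
Proof. by rewrite in_itv/= /clamp01 => /andP[x0 ->]; rewrite leNgt x0. Qed.

Lemma clamp01_nonincreasing (R : realType) (f : R -> R) :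
  (forall x, x \in `]0, 1[ -> f x \in `[0, 1]) ->
  {in `]0, 1[ &, {homo f : x y /~ x <= y}} -> nonincreasing_fun (clamp01 f).
Proof.
move=> f01 fd x y xy; rewrite /clamp01.
have f01' z : 0 < z -> z < 1 -> 0 <= f z <= 1.
  by move=> z0 z1; have := f01 z; rewrite !in_itv/= z0 z1 => /(_ isT).
case: (leP y 0) => y0; first by rewrite (le_trans xy y0).
case: (ltP y 1) => y1.
  case: (leP x 0) => x0; first by case/andP: (f01' _ y0 y1).
  have x1 := le_lt_trans xy y1; rewrite x1.
  by apply: fd; rewrite // in_itv/= ?x0 ?x1 ?y0 ?y1.
case: (leP x 0) => // x0; case: ltP => // x1.
by case/andP: (f01' _ x0 x1).
Qed.

(** The conclusion of the mean value theorem, kept as a property of the pair so that it carries over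
    to reflections. Only values of [f] inside [(0, 1)] matter. *)
Definition mean_value_density (R : realType) (f F : R -> R) : Prop :=
  (forall x, x \in `]0, 1[ -> f x \in `[0, 1]) /\
  forall x y : R, 0 <= x -> x < y -> y <= 1 ->
    exists2 c, c \in `]x, y[ & F y - F x = f c * (y - x).

Lemma superlevel_measurable (R : realType) (f : R -> R) (w : R) :
  {in `]0, 1[ &, {homo f : x y /~ x <= y}} ->
  measurable [set x : R | (x \in `]0, 1[) /\ w <= f x].
Proof.
move=> fd; apply: is_interval_measurable => x y /= [x01 fx] [y01 fy] z.
move=> /andP[xz zy].
have z01 : z \in `]0, 1[.
  move: x01 y01; rewrite !in_itv/= => /andP[x0 _] /andP[_ y1].
  by rewrite (lt_le_trans x0 xz) (le_lt_trans zy y1).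
by split=> //; apply: le_trans fy _; exact: fd.
Qed.

(** If [g x < f y], the superlevel set of [f] at height [f y] contains []0, y]] while that of [g]
    lies in []0, x[], so their measures differ. *)
Lemma equimeasurable_le (R : realType) (f g : R -> R) :
  {in `]0, 1[ &, {homo f : x y /~ x <= y}} ->
  {in `]0, 1[ &, {homo g : x y /~ x <= y}} ->
  (forall w : R,
    lebesgue_measure [set x : R | (x \in `]0, 1[) /\ w <= f x] =
    lebesgue_measure [set x : R | (x \in `]0, 1[) /\ w <= g x]) ->
  forall x y : R, x \in `]0, 1[ -> y \in `]0, 1[ -> x < y -> f y <= g x.
Proof.
move=> fd gd fg x y x01 y01 xy; rewrite leNgt; apply/negP => gf.
have [x0 x1] : 0 < x /\ x < 1 by move: x01; rewrite in_itv/= => /andP.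
have [y0 y1] : 0 < y /\ y < 1 by move: y01; rewrite in_itv/= => /andP.
have : (lebesgue_measure (`]0%R, y]%classic : set R) <=
        lebesgue_measure (`]0%R, x[%classic : set R))%E.
  apply: le_trans (_ : _ <=
     lebesgue_measure [set x : R | (x \in `]0%R, 1%R[) /\ (f y <= f x)%R])%E _.
    apply: le_measure; rewrite ?inE//; first exact: superlevel_measurable.
    move=> z /=; rewrite in_itv/= => /andP[z0 zy].
    have z01 : z \in `]0, 1[ by rewrite in_itv/= z0 (le_lt_trans zy y1).
    by split=> //; exact: fd.
  rewrite fg; apply: le_measure; rewrite ?inE//; first exact: superlevel_measurable.
  move=> z /= [z01 fz]; have := z01; rewrite !in_itv/= => /andP[-> _] /=.
  by rewrite ltNge; apply/negP => xz; have := gd _ _ z01 x01 xz; lra.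
by rewrite !lebesgue_measure_itv/= !lte_fin x0 y0 lee_fin; lra.
Qed.

(** Equimeasurability, used in both directions, makes [hs] and [f] interlace. This determines the
    integral without showing that they agree almost everywhere. *)
Lemma rearrangement_integral (R : realType) (f F hs : R -> R) :
  {in `]0, 1[ &, {homo f : x y /~ x <= y}} ->
  mean_value_density f F -> decreasing_rearrangement f hs ->
  forall x : R, 0 <= x -> x <= 1 ->
  (\int[lebesgue_measure]_(t in `]0%R, x[) (hs t)%:E)%E = (F x - F 0)%:E.
Proof.
move=> fd [f01 fF] [hsd0 fhs] x x0 x1.
have hsd : {in `]0, 1[ &, {homo hs : x y /~ x <= y}}.
  by move=> a b a01 b01 ab; exact: hsd0.
have le1 a b : a \in `]0, 1[ -> b \in `]0, 1[ -> a < b -> f b <= hs a.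
  by apply: equimeasurable_le => // w; rewrite fhs.
have le2 a b : a \in `]0, 1[ -> b \in `]0, 1[ -> a < b -> hs b <= f a.
  by apply: equimeasurable_le => // w; rewrite fhs.
(* The value [hs a] is squeezed between values of [f] at the midpoints of [(0, a)] and [(a, 1)]. *)
have hs01 a : a \in `]0, 1[ -> hs a \in `[0, 1].
  move=> a01; have := a01; rewrite !in_itv/= => /andP[a0 a1].
  have l01 : a / 2 \in `]0, 1[ by rewrite in_itv/=; apply/andP; split; lra.
  have r01 : (a + 1) / 2 \in `]0, 1[ by rewrite in_itv/=; apply/andP; split; lra.
  have al : a / 2 < a by lra.
  have ar : a < (a + 1) / 2 by lra.
  have := le1 _ _ a01 r01 ar; have := le2 _ _ l01 a01 al.
  have := f01 _ l01; have := f01 _ r01; rewrite !in_itv/=.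
  by move=> /andP[? ?] /andP[? ?] ? ?; apply/andP; split; lra.
have kd := clamp01_nonincreasing hs01 hsd.
have gd := clamp01_nonincreasing f01 fd.
have <- : \int[lebesgue_measure]_(t in `]0, x[) clamp01 hs t = F x - F 0.
  apply: (@nonincreasing_integral_eq _ (clamp01 hs) (clamp01 f)) => //.
    (* At [a = 0] or [b = 1] the clamped values 1 and 0 give the inequalities; inside, interlacing
       does. *)
    move=> a b a0 ab b1; rewrite /clamp01.
    have b0 : 0 < b by lra.
    have a1 : a < 1 by lra.
    rewrite (ltNge 0 b) in b0; rewrite (negbTE b0) a1; rewrite -ltNge in b0.
    case: (leP a 0) => ha; case: (ltP b 1) => hb //.
    - have b01 : b \in `]0, 1[ by rewrite in_itv/= b0.
      by have := f01 _ b01; have := hs01 _ b01; rewrite !in_itv/=; split; lra.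
    - have a01 : a \in `]0, 1[ by rewrite in_itv/= ha.
      have b01 : b \in `]0, 1[ by rewrite in_itv/= b0.
      by split; [exact: le2|exact: le1].
    - have a01 : a \in `]0, 1[ by rewrite in_itv/= ha.
      by have := f01 _ a01; have := hs01 _ a01; rewrite !in_itv/=; split; lra.
  move=> a b a0 ab b1; have [c] := fF _ _ a0 ab b1.
  rewrite in_itv/= => /andP[ac cb] ->.
  have c01 : c \in `]0, 1[ by rewrite in_itv/=; apply/andP; split; lra.
  have d0 : 0 <= b - a by lra.
  rewrite -(clamp01_in f c01); apply/andP.
  by split; apply: ler_wpM2r => //; apply: gd; exact: ltW.
rewrite fineK; last first.
  apply: integrable_fin_num => //; exact: nonincreasing_itv_integrable.
apply: eq_integral => t; rewrite inE/= in_itv/= => /andP[t0 tx].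
by rewrite clamp01_in// in_itv/= t0 (lt_le_trans tx x1).
Qed.

Lemma nonincreasing01_integrable (R : realType) (h : R -> R) :
  {in `]0, 1[ &, {homo h : x y /~ x <= y}} ->
  (forall x, x \in `]0, 1[ -> h x \in `[0, 1]) ->
  lebesgue_measure.-integrable `]0, 1[%classic (EFin \o h).
Proof.
move=> hd h01; apply: (@eq_integrable _ (measurableTypeR R) R lebesgue_measure _ _
  (EFin \o clamp01 h)) => //.
  by move=> x; rewrite inE/= => x01; rewrite /= clamp01_in.
by apply: nonincreasing_itv_integrable; exact: clamp01_nonincreasing.
Qed.

(** [1 - h] falls under the decreasing case, and [h] is the constant 1 minus it. *)
Lemma nondecreasing01_integrable (R : realType) (h : R -> R) :
  {in `]0, 1[ &, {homo h : x y / x <= y}} ->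
  (forall x, x \in `]0, 1[ -> h x \in `[0, 1]) ->
  lebesgue_measure.-integrable `]0, 1[%classic (EFin \o h).
Proof.
move=> hi h01; pose k x := 1 - h x.
have kint : lebesgue_measure.-integrable `]0, 1[%classic (EFin \o k).
  apply: nonincreasing01_integrable => [x y x01 y01 yx|x /h01].
    by rewrite /k lerB// hi.
  by rewrite !in_itv/= /k => /andP[? ?]; apply/andP; split; lra.
have cint : lebesgue_measure.-integrable `]0, 1[%classic (EFin \o cst (1 : R)).
  exact: nonincreasing_itv_integrable.
apply: (@eq_integrable _ (measurableTypeR R) R lebesgue_measure _ _ _ _ _
  (integrableB _ cint kint)) => //.
by move=> x _ /=; rewrite -EFinB /k; congr EFin; ring.
Qed.

(** Whatever rearrangements are chosen, their integrals over [(0, x)] are [F x] and [G x]. For the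
    converse, [f] and [g] serve as their own rearrangements. *)
Lemma schur_le_nonincreasing (R : realType) (f g F G : R -> R) :
  {in `]0, 1[ &, {homo f : x y /~ x <= y}} ->
  {in `]0, 1[ &, {homo g : x y /~ x <= y}} ->
  mean_value_density f F -> mean_value_density g G ->
  F 0 = 0 -> G 0 = 0 -> F 1 = G 1 ->
  schur_le f g <-> forall x : R, x \in `]0, 1[ -> F x <= G x.
Proof.
move=> fd gd fF gG F0 G0 FG1.
have F_int := rearrangement_integral fd fF.
have G_int := rearrangement_integral gd gG.
have rearr_self (h : R -> R) : {in `]0, 1[ &, {homo h : x y /~ x <= y}} ->
    decreasing_rearrangement h h.
  by move=> hd; split=> // x y x01 y01 xy; exact: hd.
split=> [[_ _ [fs [gs [ffs ggs + _]]]] x x01|FG].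
  have /andP[x0 x1] : 0 < x < 1 by move: x01; rewrite in_itv.
  move=> /(_ _ x01).
  rewrite (F_int fs ffs x (ltW x0) (ltW x1)) (G_int gs ggs x (ltW x0) (ltW x1)).
  by rewrite F0 G0 !subr0 lee_fin.
split; [exact: nonincreasing01_integrable fd fF.1|exact: nonincreasing01_integrable gd gG.1|].
exists f, g; split; [exact: rearr_self|exact: rearr_self| |].
- move=> x x01.
  have /andP[x0 x1] : 0 < x < 1 by move: x01; rewrite in_itv.
  rewrite (F_int f (rearr_self f fd) x (ltW x0) (ltW x1)).
  rewrite (G_int g (rearr_self g gd) x (ltW x0) (ltW x1)).
  by rewrite F0 G0 !subr0 lee_fin FG.
- rewrite F_int //; last exact: rearr_self.
  rewrite G_int //; last exact: rearr_self.
  by rewrite F0 G0 FG1.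
Qed.

(** * Reflection at 1/2 and increasing functions *)

(** The types carry the measurable structure, so that the map can be declared measurable and push
    measures forward. *)
Definition reflect01 (R : realType) (x : measurableTypeR R) : measurableTypeR R :=
  1 - x.

Lemma reflect01_measurable (R : realType) :
  measurable_fun [set: measurableTypeR R] (@reflect01 R).
Proof. by apply: nonincreasing_measurable => // x y xy; rewrite lerB. Qed.

HB.instance Definition _ (R : realType) :=
  isMeasurableFun.Build _ _ _ _ (@reflect01 R) (@reflect01_measurable R).

(** By uniqueness of Lebesgue measure half-open intervals suffice: the preimage of []a, b]] is [[1 -
    b, 1 - a[], of the same length. *)
Lemma lebesgue_measure_reflect01 (R : realType) (A : set R) : measurable A ->
  pushforward lebesgue_measure (@reflect01 R) A = lebesgue_measure A.
Proof.
move=> mA; apply/esym/lebesgue_measure_unique => //= _ [[a b]] _ <-.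
rewrite /pushforward (_ : _ @^-1` _ = `[1 - b, 1 - a[%classic); last first.
  by apply/seteqP; split=> x; rewrite /= !in_itv/= /reflect01 => /andP[? ?];
    apply/andP; split; lra.
rewrite /= !lebesgue_measure_itv/= !lte_fin ltrD2l ltrN2.
by case: ifP => // _; rewrite -!EFinB; congr EFin; ring.
Qed.

(** The superlevel sets of [f] and of its reflection are mirror images. Monotonicity makes them
    intervals, hence measurable. *)
Lemma decreasing_rearrangement_reflection (R : realType) (f hs : R -> R) :
  {in `]0, 1[ &, {homo f : x y / x <= y}} ->
  decreasing_rearrangement f hs <->
  decreasing_rearrangement (fun x => f (1 - x)) hs.
Proof.
move=> fi; suff E w :
    lebesgue_measure [set x : R | (x \in `]0, 1[) /\ w <= f (1 - x)] =
    lebesgue_measure [set x : R | (x \in `]0, 1[) /\ w <= f x].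
  by split=> -[hsd fhs]; split=> // w; rewrite fhs E.
rewrite -(@lebesgue_measure_reflect01 _ [set x | _ /\ w <= f x]).
  rewrite /pushforward; congr lebesgue_measure; apply/seteqP.
  by split=> x /=; rewrite /reflect01 !in_itv/= => -[/andP[? ?] ->];
    split=> //; apply/andP; split; lra.
apply: is_interval_measurable => x y /= [x01 fx] [y01 fy] z /andP[xz zy].
have z01 : z \in `]0, 1[.
  move: x01 y01; rewrite !in_itv/= => /andP[x0 _] /andP[_ y1].
  by rewrite (lt_le_trans x0 xz) (le_lt_trans zy y1).
by split=> //; apply: le_trans fx _; exact: fi.
Qed.

(** The reflected functions decrease and have primitives [F 1 - F (1 - x)] and [G 1 - G (1 - x)]. As
    [F 1 = G 1], comparing these reverses the inequality between [F] and [G]. *)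
Lemma schur_le_nondecreasing (R : realType) (f g F G : R -> R) :
  {in `]0, 1[ &, {homo f : x y / x <= y}} ->
  {in `]0, 1[ &, {homo g : x y / x <= y}} ->
  mean_value_density f F -> mean_value_density g G ->
  F 0 = 0 -> G 0 = 0 -> F 1 = G 1 ->
  schur_le f g <-> forall x : R, x \in `]0, 1[ -> G x <= F x.
Proof.
move=> fi gi fF gG F0 G0 FG1.
have refl01 (x : R) : x \in `]0, 1[ -> 1 - x \in `]0, 1[.
  by rewrite !in_itv/= => /andP[? ?]; apply/andP; split; lra.
have refl_homo (h : R -> R) : {in `]0, 1[ &, {homo h : x y / x <= y}} ->
    {in `]0, 1[ &, {homo (fun x => h (1 - x)) : x y /~ x <= y}}.
  by move=> hi x y x01 y01 yx; apply: hi; [exact: refl01|exact: refl01|lra].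
have refl_mean (h H : R -> R) : mean_value_density h H ->
    mean_value_density (fun x => h (1 - x)) (fun x => H 1 - H (1 - x)).
  move=> [h01 hH]; split=> [x x01|x y x0 xy y1]; first exact/h01/refl01.
  have [|||c] := hH (1 - y) (1 - x); [lra..|].
  rewrite in_itv/= => /andP[c1 c2] hE; exists (1 - c).
    by rewrite in_itv/=; apply/andP; split; lra.
  by rewrite (_ : 1 - (1 - c) = c); [lra|ring].
(* The Schur order only sees rearrangements, which reflection preserves. *)
have -> : schur_le f g <->
    schur_le (fun x => f (1 - x)) (fun x => g (1 - x)).
  split=> -[fint gint [fs [gs [ffs ggs le eq]]]]; split.
  - apply: nonincreasing01_integrable; first exact: refl_homo.
    by move=> x x01; exact/fF.1/refl01.
  - apply: nonincreasing01_integrable; first exact: refl_homo.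
    by move=> x x01; exact/gG.1/refl01.
  - exists fs, gs; split=> //.
      exact: (iffLR (decreasing_rearrangement_reflection fs fi)).
    exact: (iffLR (decreasing_rearrangement_reflection gs gi)).
  - exact: nondecreasing01_integrable fF.1.
  - exact: nondecreasing01_integrable gG.1.
  - exists fs, gs; split=> //.
      exact: (iffRL (decreasing_rearrangement_reflection fs fi)).
    exact: (iffRL (decreasing_rearrangement_reflection gs gi)).
rewrite (@schur_le_nonincreasing _ _ _ (fun x => F 1 - F (1 - x))
  (fun x => G 1 - G (1 - x))); first last.
- by rewrite !subrr F0 G0 FG1.
- by rewrite subr0 subrr.
- by rewrite subr0 subrr.
- exact: refl_mean.
- exact: refl_mean.
- exact: refl_homo.
- exact: refl_homo.
split=> FG x /refl01 /FG.
  by rewrite (_ : 1 - (1 - x) = x); [lra|ring].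
by lra.
Qed.

(** * Monotone Lipschitz functions on the unit interval *)

(** The derivative is in particular the limit of the right difference quotients. *)
Lemma derive1_le_right_slope (R : realType) (f : R -> R) (a c : R) :
  derivable f a 1 -> (\forall h \near 0^'+, f (h + a) - f a <= c * h) ->
  derive1 f a <= c.
Proof.
move=> df slope; rewrite derive1E.
have cv : h^-1 *: (f (h + a) - f a) @[h --> 0^'+] --> 'D_1 f a.
  apply: cvg_dnbhs_at_right; move: df; rewrite /derivable /derive /=.
  by under eq_fun do rewrite /= scaler1.
apply: (cvgr_to_le cv); near=> h.
have h0 : 0 < h by near: h; exact: nbhs_right_gt.
rewrite /GRing.scale/= mulrC ler_pdivrMr//.
by near: h.
Unshelve. all: by end_near. Qed.

Lemma derive1_01 (R : realType) (F : R -> R) (u : R) :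
  (forall x y : R, 0 <= x -> x <= y -> y <= 1 -> 0 <= F y - F x <= y - x) ->
  u \in `]0, 1[ -> derivable F u 1 -> derive1 F u \in `[0, 1].
Proof.
move=> Flip; rewrite in_itv/= => /andP[u0 u1] dF.
have incr : \forall h \near 0^'+, 0 <= F (h + u) - F u <= h.
  near=> h.
  have h0 : 0 < h by near: h; exact: nbhs_right_gt.
  have h1 : h <= 1 - u by near: h; apply: nbhs_right_le; rewrite subr_gt0.
  have := Flip u (h + u); rewrite addrK; apply; lra.
rewrite in_itv/=; apply/andP; split.
  (* The lower bound is the upper bound 0 for the derivative of [- F]. *)
  rewrite -oppr_le0 -derive1N//.
  apply: derive1_le_right_slope; first exact: derivableN.
  apply: filterS incr => h /andP[Fh _].
  by change (- F (h + u) - - F u <= 0 * h); lra.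
apply: derive1_le_right_slope => //.
by apply: filterS incr => h /andP[_ ?]; rewrite mul1r.
Unshelve. all: by end_near. Qed.

Lemma lipschitz01_continuous (R : realType) (F : R -> R) :
  (forall x y : R, 0 <= x -> x <= y -> y <= 1 -> 0 <= F y - F x <= y - x) ->
  {within `[0, 1], continuous F}.
Proof.
move=> Flip; apply/subspace_continuousP => x /=; rewrite in_itv/= => /andP[x0 x1].
apply/cvgrPdist_lt => e e0; near=> y.
have : y \in `[0, 1] by near: y; exact: withinT.
rewrite in_itv/= => /andP[y0 y1].
have xy : `|x - y| < e.
  near: y; apply: cvg_within; by apply/nbhs_ballP; exists e.
apply: le_lt_trans xy.
case: (leP x y) => [xy|/ltW yx].
  have /andP[? ?] := Flip _ _ x0 xy y1.
  by rewrite distrC ger0_norm// distrC ger0_norm// subr_ge0.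
have /andP[? ?] := Flip _ _ y0 yx x1.
by rewrite ger0_norm// ger0_norm// subr_ge0.
Unshelve. all: by end_near. Qed.

(** Derivability is available inside [(0, 1)] only; at the endpoints the Lipschitz bound supplies
    the continuity that the mean value theorem asks for. *)
Lemma mean_value_of_derivable (R : realType) (F : R -> R) (x y : R) :
  (forall x y : R, 0 <= x -> x <= y -> y <= 1 -> 0 <= F y - F x <= y - x) ->
  (forall u : R, u \in `]0, 1[ -> derivable F u 1) ->
  0 <= x -> x < y -> y <= 1 ->
  exists2 c, c \in `]x, y[ & F y - F x = derive1 F c * (y - x).
Proof.
move=> Flip dF x0 xy y1; apply: MVT => //.
  move=> c; rewrite in_itv/= => /andP[xc cy]; rewrite derive1E.
  by apply/derivableP/dF; rewrite in_itv/=; apply/andP; split; lra.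
apply: continuous_subspaceW (lipschitz01_continuous Flip) => t /=.
by rewrite !in_itv/= => /andP[? ?]; apply/andP; split; lra.
Qed.

(** The two bounds are the nonnegative volumes of [[x, y] * [0, v]] and [[x, y] * [v, 1]]. *)
Lemma copula_section_increment1 (R : realType) (C : R -> R -> R) (v x y : R) :
  copula C -> v \in `[0, 1] -> 0 <= x -> x <= y -> y <= 1 ->
  0 <= C y v - C x v <= y - x.
Proof.
move=> [Crange Cground Cmarg C2] v01 x0 xy y1.
have x01 : x \in `[0, 1] by rewrite in_itv/= x0 (le_trans xy).
have y01 : y \in `[0, 1] by rewrite in_itv/= y1 (le_trans x0).
have i0 : (0 : R) \in `[0, 1] by rewrite in_itv/= lexx ler01.
have i1 : (1 : R) \in `[0, 1] by rewrite in_itv/= lexx ler01.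
have /andP[v0 v1] : 0 <= v <= 1 by move: v01; rewrite in_itv.
have := C2 _ _ _ _ x01 y01 i0 v01 xy v0.
have := C2 _ _ _ _ x01 y01 v01 i1 xy v1.
rewrite (Cmarg x x01).1 (Cmarg y y01).1 (Cground x x01).1 (Cground y y01).1.
by move=> ? ?; apply/andP; split; lra.
Qed.

(** * Generators and the lower orthant order *)

Lemma itv01_0 (R : realType) : (0 : R) \in `[0, 1].
Proof. by rewrite in_itv/= lexx ler01. Qed.

Lemma itv01_1 (R : realType) : (1 : R) \in `[0, 1].
Proof. by rewrite in_itv/= lexx ler01. Qed.

Lemma generator_le (R : realType) (phi : R -> \bar R) (u v : R) :
  generator phi -> u \in `[0, 1] -> v \in `[0, 1] ->
  (phi v <= phi u)%E = (u <= v).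
Proof.
move=> gphi u01 v01; case: (leP u v) => [|vu].
  rewrite le_eqVlt => /predU1P[->|uv]; first exact: lexx.
  by apply/ltW; exact: (generator_decreasing gphi).
by apply/negbTE; rewrite -ltNge; exact: (generator_decreasing gphi).
Qed.

Lemma generator_lt (R : realType) (phi : R -> \bar R) (u v : R) :
  generator phi -> u \in `[0, 1] -> v \in `[0, 1] ->
  (phi v < phi u)%E = (u < v).
Proof. by move=> gphi u01 v01; rewrite !ltNge generator_le. Qed.

Lemma generator_inj (R : realType) (phi : R -> \bar R) (u v : R) :
  generator phi -> u \in `[0, 1] -> v \in `[0, 1] -> phi u = phi v -> u = v.
Proof.
move=> gphi u01 v01 uv; apply/eqP.
by rewrite eq_le -!(generator_le gphi)// uv lexx.
Qed.

Lemma generator_fin_num (R : realType) (phi : R -> \bar R) (u : R) :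
  generator phi -> 0 < u -> u <= 1 -> phi u \is a fin_num.
Proof.
move=> gphi u0 u1.
have u01 : u \in `[0, 1] by rewrite in_itv/= ltW.
rewrite ge0_fin_numE; last exact: (generator_ge0 gphi).
apply: lt_le_trans (leey (phi 0)).
by rewrite (generator_lt gphi)// itv01_0.
Qed.

Lemma generator_surj (R : realType) (phi : R -> \bar R) (t : \bar R) :
  generator phi -> (0 <= t)%E -> (t <= phi 0%R)%E ->
  exists2 u : R, u \in `[0, 1] & phi u = t.
Proof.
move=> gphi t0; rewrite le_eqVlt => /predU1P[->|tphi0].
  by exists 0 => //; exact: itv01_0.
have tfin : t \is a fin_num by rewrite ge0_fin_numE// (lt_le_trans tphi0)// leey.
have /subspace_continuousP cphi := generator_continuous gphi.
(* Since [phi 0] may be infinite, continuity at 0 first yields [a > 0] with [phi a] above [t]; the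
   intermediate value theorem is then applied to the finite values on [[a, 1]]. *)
have [a a0 [a1 ta]] : exists2 a : R, 0 < a & a <= 1 /\ (t < phi a)%E.
  have /= c0 := cphi 0 (itv01_0 R).
  have nt : nbhs (phi 0) [set y | (t < y)%E] by exact: open_ereal_gt'.
  have := c0 _ nt; rewrite /= nbhs_simpl /= => -[e /= e0 He].
  exists (Num.min (e / 2) 1); first by rewrite lt_min ltr01 divr_gt0.
  split; first by rewrite ge_min lexx orbT.
  have m0 : 0 < Num.min (e / 2) 1 by rewrite lt_min ltr01 divr_gt0.
  apply: He; rewrite /ball/= ?in_itv/=.
    rewrite sub0r normrN gtr0_norm// gt_min; apply/orP; left; lra.
  by rewrite ltW//= ge_min lexx orbT.
have fin x : x \in `[a, 1] -> phi x \is a fin_num.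
  rewrite in_itv/= => /andP[ax x1].
  by apply: (generator_fin_num gphi) => //; exact: lt_le_trans ax.
have sub01 x : x \in `[a, 1] -> x \in `[0, 1].
  by rewrite !in_itv/= => /andP[ax ->]; rewrite andbT; lra.
have cfine : {within `[a, 1], continuous (fine \o phi)}.
  apply/subspace_continuousP => x xa.
  apply: fine_cvg; rewrite fineK; last exact: fin.
  apply: cvg_trans (cphi x (sub01 _ xa)).
  apply: cvg_app; apply: within_subset => y /=; exact: sub01.
have [|c ca cE] := @IVT _ (fine \o phi) a 1 (fine t) a1 cfine.
- rewrite /= (generator1 gphi) /= ge_min le_max; apply/andP; split.
    by apply/orP; right; exact: fine_ge0.
  apply/orP; left; apply: fine_le => //; last exact: ltW.
  by apply: fin; rewrite in_itv/= lexx.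
exists c; first exact: sub01.
by rewrite -(fineK (fin _ ca)) -(fineK tfin); congr EFin.
Qed.

Lemma inverse_generatorK (R : realType) (phi : R -> \bar R) (u : R) :
  generator phi -> u \in `[0, 1] -> inverse_generator phi (phi u) = u.
Proof.
move=> gphi u01; have u0 : 0 <= u by move: u01; rewrite in_itv/= => /andP[].
rewrite /inverse_generator (generator_le gphi)// ?itv01_0// u0.
case: xgetP => [x _ [x01 xu]|/(_ u)]; first exact: (generator_inj gphi).
by case.
Qed.

Lemma inverse_generator01 (R : realType) (phi : R -> \bar R) (t : \bar R) :
  inverse_generator phi t \in `[0, 1].
Proof.
rewrite /inverse_generator; case: ifP => _; last exact: itv01_0.
by case: xgetP => [x _ []//|_]; exact: itv01_0.
Qed.

Lemma generatorK (R : realType) (phi : R -> \bar R) (t : \bar R) :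
  generator phi -> (0 <= t)%E -> (t <= phi 0%R)%E ->
  phi (inverse_generator phi t) = t.
Proof.
move=> gphi t0 tphi0; have [u u01 <-] := generator_surj gphi t0 tphi0.
by rewrite inverse_generatorK.
Qed.

Lemma inverse_generator_eq0 (R : realType) (phi : R -> \bar R) (t : \bar R) :
  generator phi -> (phi 0%R <= t)%E -> inverse_generator phi t = 0.
Proof.
move=> gphi; rewrite le_eqVlt => /predU1P[<-|tphi].
  by rewrite inverse_generatorK// itv01_0.
by rewrite /inverse_generator leNgt tphi.
Qed.

(** Equality holds up to [phi 0]; beyond, the inverse is 0 and [phi 0 < t]. *)
Lemma generator_inverse_le (R : realType) (phi : R -> \bar R) (t : \bar R) :
  generator phi -> (0 <= t)%E -> (phi (inverse_generator phi t) <= t)%E.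
Proof.
move=> gphi t0; case: (leP t (phi 0)) => tphi; first by rewrite generatorK.
by rewrite inverse_generator_eq0// ltW.
Qed.

Lemma inverse_generator_anti (R : realType) (phi : R -> \bar R) (s t : \bar R) :
  generator phi -> (0 <= s)%E -> (s <= t)%E ->
  inverse_generator phi t <= inverse_generator phi s.
Proof.
move=> gphi s0 st; have t0 := le_trans s0 st.
case: (leP t (phi 0)) => tphi; last first.
  rewrite inverse_generator_eq0//; last exact: ltW.
  by have := inverse_generator01 phi s; rewrite in_itv/= => /andP[].
rewrite -(generator_le gphi) ?inverse_generator01// !generatorK//.
exact: le_trans tphi.
Qed.

Lemma lower_orthant_le_subadditive (R : realType) (phi1 phi2 : R -> \bar R)
    (D1 D2 : R -> R -> R) :
  archimedean_copula phi1 D1 -> archimedean_copula phi2 D2 ->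
  lower_orthant_le D1 D2 <->
  subadditive_nneg (phi1 \o (fun t : R => inverse_generator phi2 t%:E)).
Proof.
move=> [cD1 g1 E1] [cD2 g2 E2]; split=> [D12 x y x0 y0 /=|sub u v u01 v01].
  set u := inverse_generator phi2 x%:E; set v := inverse_generator phi2 y%:E.
  have u01 : u \in `[0, 1] by exact: inverse_generator01.
  have v01 : v \in `[0, 1] by exact: inverse_generator01.
  have pu := generator_ge0 g1 u01; have pv := generator_ge0 g1 v01.
  (* The right-hand side dominates [phi1 (D1 u v)], so [D1 u v <= psi2 (x + y)] is enough. *)
  apply: le_trans (generator_inverse_le g1 (adde_ge0 pu pv)).
  rewrite (generator_le g1) ?inverse_generator01//.
  have := D12 u v u01 v01; rewrite E1// E2// => /le_trans; apply.
  rewrite EFinD.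
  (* If [x] or [y] exceeds [phi2 0], then [u] or [v] is 0 and both sides vanish. *)
  have [x2|/ltW x2] := leP x%:E (phi2 0); last first.
    rewrite [X in _ <= X]inverse_generator_eq0//; last first.
      by rewrite (le_trans x2)// leeDl// lee_fin.
    rewrite inverse_generator_eq0//.
    rewrite /u (inverse_generator_eq0 g2 x2) leeDl//.
    exact: (generator_ge0 g2).
  have [y2|/ltW y2] := leP y%:E (phi2 0); last first.
    rewrite [X in _ <= X]inverse_generator_eq0//; last first.
      by rewrite (le_trans y2)// leeDr// lee_fin.
    rewrite inverse_generator_eq0//.
    rewrite /v (inverse_generator_eq0 g2 y2) leeDr//.
    exact: (generator_ge0 g2).
  by rewrite /u /v !generatorK ?lee_fin.
have [u0 u1] : 0 <= u /\ u <= 1 by move: u01; rewrite in_itv/= => /andP.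
have [v0 v1] : 0 <= v /\ v <= 1 by move: v01; rewrite in_itv/= => /andP.
have D2ge0 : 0 <= D2 u v.
  by have := copula_range cD2 u01 v01; rewrite in_itv/= => /andP[].
(* Zero arguments are settled by groundedness, because [phi2] may be infinite there. *)
move: u0; rewrite le_eqVlt => /predU1P[u0|u0].
  by rewrite (_ : D1 u v = 0)// -u0 (copula_grounded cD1 v01).2.
move: v0; rewrite le_eqVlt => /predU1P[v0|v0].
  by rewrite (_ : D1 u v = 0)// -v0 (copula_grounded cD1 u01).1.
have fu := generator_fin_num g2 u0 u1; have fv := generator_fin_num g2 v0 v1.
have := sub (fine (phi2 u)) (fine (phi2 v)).
rewrite /= EFinD !fineK// !inverse_generatorK// => sub'.
have pu := generator_ge0 g2 u01; have pv := generator_ge0 g2 v01.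
rewrite E1// E2//.
rewrite -[leRHS](inverse_generatorK g1 (inverse_generator01 _ _)).
apply: inverse_generator_anti => //.
  by apply: (generator_ge0 g1); exact: inverse_generator01.
by apply: sub'; exact: fine_ge0.
Qed.

(** * Derivatives of Archimedean copulas *)

(* By convexity phi lies below its chord on [u / 2, u], whose slope - M bounds
   the right difference quotients of psi at phi u by - M^-1. *)
Lemma inverse_generator_derive1_lt0 (R : realType) (phi : R -> \bar R) (u : R) :
  let psi := fun t : R => inverse_generator phi t%:E in
  generator phi -> 0 < u -> u < 1 -> derivable psi (fine (phi u)) 1 ->
  derive1 psi (fine (phi u)) < 0.
Proof.
move=> psi gphi u0 u1 dpsi.
have u01 : u \in `[0, 1] by rewrite in_itv/= !ltW.
have w0 : 0 < u / 2 by lra.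
have w01 : u / 2 \in `[0, 1] by rewrite in_itv/=; apply/andP; split; lra.
have fu : phi u \is a fin_num by exact: generator_fin_num (ltW u1).
have fw : phi (u / 2) \is a fin_num by apply: (generator_fin_num gphi) => //; lra.
have a0 : 0 <= fine (phi u) by exact/fine_ge0/(generator_ge0 gphi).
have aw : fine (phi u) < fine (phi (u / 2)).
  by rewrite fine_lt// (generator_lt gphi)//; lra.
set a := fine (phi u) in a0 aw dpsi *; set b := fine (phi (u / 2)) in aw *.
(* Minus the slope of the chord of [phi] over [[u / 2, u]]. *)
pose M := (b - a) / (u / 2).
have M0 : 0 < M by rewrite divr_gt0// subr_gt0.
apply: (@le_lt_trans _ _ (- M^-1)); last by rewrite oppr_lt0 invr_gt0.
apply: derive1_le_right_slope => //; near=> h.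
have h0 : 0 < h by near: h; exact: nbhs_right_gt.
(* This keeps [psi (h + a)] inside [(u / 2, u)], where the chord bound applies. *)
have hb : h < b - a by near: h; apply: nbhs_right_lt; rewrite subr_gt0.
have psia : psi a = u by rewrite /psi /a fineK// inverse_generatorK.
have t0 : (0 <= (h + a)%:E)%E by rewrite lee_fin; lra.
have tb : ((h + a)%:E < phi (u / 2)%R)%E by rewrite -(fineK fw) lte_fin -/b; lra.
have tphi0 : ((h + a)%:E <= phi 0%R)%E.
  apply/ltW/(lt_le_trans tb).
  by rewrite (generator_le gphi) ?itv01_0// ltW.
have phix : phi (psi (h + a)) = (h + a)%:E by exact: generatorK.
have x01 : psi (h + a) \in `[0, 1] by exact: inverse_generator01.
have xu : psi (h + a) < u.
  by rewrite -(generator_lt gphi)// phix -(fineK fu) lte_fin -/a; lra.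
have wx : u / 2 < psi (h + a) by rewrite -(generator_lt gphi)// phix.
rewrite psia; set x := psi (h + a) in phix x01 xu wx *.
(* The weight with [x = s * (u / 2) + (1 - s) * u]. *)
pose s := (u - x) / (u / 2).
have s01 : s \in `[0, 1].
  rewrite in_itv/= divr_ge0 ?ler_pdivrMr//=; lra.
have := generator_convex gphi w01 u01 s01.
have -> : s * (u / 2) + (1 - s) * u = x by rewrite /s; field; lra.
rewrite phix -(fineK fw) -(fineK fu) -!EFinM -EFinD lee_fin -/a -/b => conv.
have hs : h <= (u - x) * M.
  have -> : (u - x) * M = s * (b - a) by rewrite /s /M; field; lra.
  lra.
by rewrite mulNr; have : M^-1 * h <= u - x; [rewrite mulrC ler_pdivrMr|lra].
Unshelve. all: by end_near. Qed.

Lemma fine_generator_gt0 (R : realType) (phi : R -> \bar R) (u : R) :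
  generator phi -> 0 < u -> u < 1 -> 0 < fine (phi u).
Proof.
move=> gphi u0 u1; apply: fine_gt0; apply/andP; split.
  have := @generator_lt _ phi u 1 gphi; rewrite (generator1 gphi) => -> //.
    by rewrite in_itv/= !ltW.
  exact: itv01_1.
by have := generator_fin_num gphi u0 (ltW u1); rewrite fin_numE ltey => /andP[].
Qed.

(** The inverse function rule applied to [psi] at [phi u], where its derivative is negative. *)
Lemma generator_is_derive (R : realType) (phi : R -> \bar R) (u : R) :
  let psi := fun t : R => inverse_generator phi t%:E in
  generator phi -> differentiable_pos psi -> 0 < u -> u < 1 ->
  is_derive u 1 (fine \o phi) (derive1 psi (fine (phi u)))^-1.
Proof.
move=> psi gphi dpsi u0 u1.
have u01 : u \in `[0, 1] by rewrite in_itv/= !ltW.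
have fu : phi u \is a fin_num by exact: generator_fin_num (ltW u1).
have a0 : 0 < fine (phi u) by exact: fine_generator_gt0.
have psia : psi (fine (phi u)) = u by rewrite /psi fineK// inverse_generatorK.
have near_pos : \forall t \near fine (phi u), 0 < t by exact: lt_nbhsr.
rewrite -{1}psia; apply: is_derive_inverse.
- have w01 : u / 2 \in `[0, 1] by rewrite in_itv/=; apply/andP; split; lra.
  have fw : phi (u / 2) \is a fin_num by apply: (generator_fin_num gphi) => //; lra.
  have aw : fine (phi u) < fine (phi (u / 2)).
    by rewrite fine_lt// (generator_lt gphi)//; lra.
  (* Near [phi u], [t] stays below the finite value [phi (u / 2)], hence in the range where [phi]
     inverts [psi]. *)
  near=> t; rewrite /= /psi generatorK//.
    by rewrite lee_fin ltW//; near: t.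
  apply: (@le_trans _ _ (phi (u / 2)%R)); last first.
    by rewrite (generator_le gphi) ?itv01_0//; lra.
  by rewrite -(fineK fw) lee_fin ltW//; near: t; exact: lt_nbhsl.
- apply: filterS near_pos => t t0.
  by apply: differentiable_continuous; exact/derivable1_diffP/dpsi.
- by rewrite derive1E; exact/derivableP/dpsi.
- by rewrite lt_eqF//; apply: inverse_generator_derive1_lt0 => //; exact: dpsi.
Unshelve. all: by end_near. Qed.

Lemma archimedean_section_is_derive (R : realType) (phi : R -> \bar R)
    (F : R -> R) (u v : R) :
  let psi := fun t : R => inverse_generator phi t%:E in
  generator phi -> differentiable_pos psi ->
  u \in `]0, 1[ -> v \in `]0, 1[ ->
  (forall x, x \in `[0, 1] -> F x = inverse_generator phi (phi x + phi v)%E) ->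
  is_derive u 1 F (derive1 psi (fine (phi u) + fine (phi v)) /
                   derive1 psi (fine (phi u))).
Proof.
move=> psi gphi dpsi; rewrite !in_itv/= => /andP[u0 u1] /andP[v0 v1] FE.
have fin x : 0 < x -> x < 1 -> phi x \is a fin_num.
  by move=> x0 x1; exact: generator_fin_num (ltW x1).
(* Near [u] both generator values are finite, so the extended sum is a real one and the chain rule
   applies. *)
apply: (@near_eq_is_derive _ _ _ (psi \o (fun x => fine (phi x) + fine (phi v)))).
  near=> x.
  have x0 : 0 < x by near: x; exact: lt_nbhsr.
  have x1 : x < 1 by near: x; exact: lt_nbhsl.
  by rewrite FE ?in_itv/= ?ltW// /psi EFinD !fineK ?fin.
apply: is_derive1_comp.
  by rewrite derive1E; apply/derivableP/dpsi; rewrite addr_gt0// fine_generator_gt0.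
have := generator_is_derive gphi dpsi u0 u1.
move=> /(@is_deriveD _ _ _ _ (cst (fine (phi v))) u 1 _ 0).
by rewrite addr0; apply; exact: is_derive_cst.
Unshelve. all: by end_near. Qed.

(** * Log-convexity and monotone derivatives *)

(** [a + s] and [b] lie between [a] and [b + s] and have the same sum as these, so their weights are
    complementary. *)
Lemma shift_weights (R : realType) (a b s : R) : a < b -> 0 < s ->
  exists l : R, [/\ 0 < l < 1, l * a + (1 - l) * (b + s) = a + s &
                  (1 - l) * a + (1 - (1 - l)) * (b + s) = b].
Proof.
move=> ab s0; have d0 : 0 < b + s - a by lra.
exists ((b - a) / (b + s - a)); split; [|by field; lra|by field; lra].
by rewrite divr_gt0//= ?ltr_pdivrMr//; lra.
Qed.

Lemma powR_weights (R : realType) (x l : R) : 0 <= x ->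
  x `^ l * x `^ (1 - l) = x.
Proof. by move=> x0; rewrite -powRD subrKC ?powRr1// oner_eq0. Qed.

(** Multiplying the log-convexity bounds at [a + s] and [b] recombines the complementary powers into
    [g a * g (b + s)]. *)
Lemma log_convex_shift (R : realType) (g : R -> R) (a b s : R) :
  log_convex g -> 0 < a -> a < b -> 0 < s -> g (a + s) * g b <= g a * g (b + s).
Proof.
move=> [g0 gc] a0 ab s0; have [l [l01 e1 e2]] := shift_weights ab s0.
have l01' : 0 < 1 - l < 1 by lra.
have bs0 : 0 < b + s by lra.
have H1 := gc _ _ _ a0 bs0 l01; have H2 := gc _ _ _ a0 bs0 l01'.
rewrite e1 in H1; rewrite e2 subKr in H2.
rewrite -[X in _ <= X * _](powR_weights l (g0 _ a0)).
rewrite -[X in _ <= _ * X](powR_weights l (g0 _ bs0)).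
rewrite [leRHS](_ : _ = (g a `^ l * g (b + s) `^ (1 - l)) *
  (g a `^ (1 - l) * g (b + s) `^ l)); last by ring.
apply: ler_pM => //; apply: g0; lra.
Qed.

Lemma log_concave_shift (R : realType) (g : R -> R) (a b s : R) :
  log_concave g -> 0 < a -> a < b -> 0 < s -> g a * g (b + s) <= g (a + s) * g b.
Proof.
move=> [g0 gc] a0 ab s0; have [l [l01 e1 e2]] := shift_weights ab s0.
have l01' : 0 < 1 - l < 1 by lra.
have bs0 : 0 < b + s by lra.
have H1 := gc _ _ _ a0 bs0 l01; have H2 := gc _ _ _ a0 bs0 l01'.
rewrite e1 in H1; rewrite e2 subKr in H2.
rewrite -[X in X * _ <= _](powR_weights l (g0 _ a0)).
rewrite -[X in _ * X <= _](powR_weights l (g0 _ bs0)).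
rewrite [leLHS](_ : _ = (g a `^ l * g (b + s) `^ (1 - l)) *
  (g a `^ (1 - l) * g (b + s) `^ l)); last by ring.
by apply: ler_pM => //; rewrite mulr_ge0// powR_ge0.
Qed.

(** All copulas agree on the boundary of the square. *)
Lemma lower_orthant_le_interior (R : realType) (C D : R -> R -> R) :
  copula C -> copula D ->
  lower_orthant_le C D <->
  (forall v : R, v \in `]0, 1[ -> forall u : R, u \in `]0, 1[ -> C u v <= D u v).
Proof.
move=> cC cD; split=> [CD v v01 u u01|CD u v u01 v01].
  by apply: CD; apply: subset_itv_oo_cc.
have := u01; rewrite in_itv/= => /andP[+ +].
rewrite le_eqVlt => /predU1P[<-|u0].
  by rewrite (copula_grounded cC v01).2 (copula_grounded cD v01).2.
rewrite le_eqVlt => /predU1P[->|u1].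
  by rewrite (copula_margins cC v01).2 (copula_margins cD v01).2.
have := v01; rewrite in_itv/= => /andP[+ +].
rewrite le_eqVlt => /predU1P[<-|v0].
  by rewrite (copula_grounded cC u01).1 (copula_grounded cD u01).1.
rewrite le_eqVlt => /predU1P[->|v1].
  by rewrite (copula_margins cC u01).1 (copula_margins cD u01).1.
by apply: CD; rewrite in_itv/= ?u0 ?v0.
Qed.

(** Reduces [partial2] to [partial1] of the copula with exchanged arguments. *)
Lemma archimedean_copula_swap (R : realType) (phi : R -> \bar R)
    (D : R -> R -> R) :
  archimedean_copula phi D -> archimedean_copula phi (fun u v => D v u).
Proof.
move=> [[Dr Dg Dm D2] gphi DE]; split => //.
- split=> [u v u01 v01|u u01|u u01|u1 u2 v1 v2 u101 u201 v101 v201 u12 v12].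
  + exact: Dr.
  + by have [] := Dg _ u01.
  + by have [] := Dm _ u01.
  + by have := D2 _ _ _ _ v101 v201 u101 u201 v12 u12; lra.
- by move=> u v u01 v01; rewrite DE// addeC.
Qed.

Lemma partial1_archimedean (R : realType) (phi : R -> \bar R)
    (D : R -> R -> R) (u v : R) :
  let psi := fun t : R => inverse_generator phi t%:E in
  archimedean_copula phi D -> differentiable_pos psi ->
  u \in `]0, 1[ -> v \in `]0, 1[ ->
  derivable (D ^~ v) u 1 /\
  partial1 D u v = derive1 psi (fine (phi u) + fine (phi v)) /
                   derive1 psi (fine (phi u)).
Proof.
move=> psi [_ gphi DE] dpsi u01 v01.
have v01' : v \in `[0, 1] by exact: subset_itv_oo_cc v01.
have dD := @archimedean_section_is_derive _ phi (D ^~ v) u v gphi dpsi u01 v01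
  (fun x x01 => DE x v x01 v01').
by split; [exact: ex_derive|rewrite /partial1 derive1E; exact: derive_val].
Qed.

Lemma partial1_mean_value (R : realType) (phi : R -> \bar R)
    (D : R -> R -> R) (v : R) :
  archimedean_copula phi D ->
  differentiable_pos (fun t : R => inverse_generator phi t%:E) ->
  v \in `]0, 1[ -> mean_value_density (fun u => partial1 D u v) (D ^~ v).
Proof.
move=> aD dpsi v01.
have Dlip x y : 0 <= x -> x <= y -> y <= 1 -> 0 <= D y v - D x v <= y - x.
  apply: copula_section_increment1; first exact: archimedean_is_copula aD.
  exact: subset_itv_oo_cc v01.
have dD u : u \in `]0, 1[ -> derivable (D ^~ v) u 1.
  by move=> u01; have [] := partial1_archimedean aD dpsi u01 v01.
split=> [u u01|x y x0 xy y1]; first exact: derive1_01 (dD _ u01).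
exact: (@mean_value_of_derivable _ (D ^~ v)).
Qed.

(** Both derivatives are quotients with positive denominators [g (p u)] and [g (p w)], so the
    comparison is a cross-multiplication. *)
Lemma partial1_le_cross (R : realType) (phi : R -> \bar R)
    (D : R -> R -> R) (u w v : R) :
  let psi := fun t : R => inverse_generator phi t%:E in
  let g := fun t : R => - derive1 psi t in
  let p := fun x : R => fine (phi x) in
  archimedean_copula phi D -> differentiable_pos psi ->
  u \in `]0, 1[ -> w \in `]0, 1[ -> v \in `]0, 1[ ->
  (partial1 D u v <= partial1 D w v) =
  (g (p u + p v) * g (p w) <= g (p u) * g (p w + p v)).
Proof.
move=> psi g p aD dpsi u01 w01 v01.
rewrite (partial1_archimedean aD dpsi u01 v01).2.
rewrite (partial1_archimedean aD dpsi w01 v01).2 -/psi.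
have g_gt0 x : x \in `]0, 1[ -> 0 < g (p x).
  have gphi := archimedean_generator aD.
  rewrite in_itv/= oppr_gt0 => /andP[x0 x1].
  exact: inverse_generator_derive1_lt0 (dpsi _ (fine_generator_gt0 gphi x0 x1)).
rewrite -[leLHS]mulrNN -[leRHS]mulrNN -!invrN.
rewrite ler_pdivrMr ?g_gt0// mulrAC ler_pdivlMr ?g_gt0//.
by rewrite [X in _ <= X]mulrC.
Qed.

Lemma fine_generator_lt (R : realType) (phi : R -> \bar R) (u v : R) :
  generator phi -> u \in `]0, 1[ -> v \in `]0, 1[ -> u < v ->
  fine (phi v) < fine (phi u).
Proof.
move=> gphi; rewrite !in_itv/= => /andP[u0 u1] /andP[v0 v1] uv.
rewrite fine_lt ?(generator_fin_num gphi) ?ltW//.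
by rewrite (generator_lt gphi)// in_itv/= !ltW.
Qed.

Lemma partial1_nonincreasing (R : realType) (phi : R -> \bar R)
    (D : R -> R -> R) (v : R) :
  let psi := fun t : R => inverse_generator phi t%:E in
  archimedean_copula phi D -> differentiable_pos psi ->
  log_convex (fun t => - derive1 psi t) -> v \in `]0, 1[ ->
  {in `]0, 1[ &, {homo (fun u => partial1 D u v) : x y /~ x <= y}}.
Proof.
move=> psi aD dpsi lc v01 x y x01 y01; rewrite le_eqVlt => /predU1P[->//|yx].
have gphi := archimedean_generator aD.
rewrite (partial1_le_cross aD dpsi x01 y01 v01).
have pos z : z \in `]0, 1[ -> 0 < fine (phi z).
  by rewrite in_itv/= => /andP[]; exact: fine_generator_gt0.
(* Here [a], [b], [s] are the generator values at [x], [y], [v]; [y < x] gives [a < b]. *)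
apply: (log_convex_shift lc); [exact: pos| |exact: pos].
exact: (fine_generator_lt gphi).
Qed.

Lemma partial1_nondecreasing (R : realType) (phi : R -> \bar R)
    (D : R -> R -> R) (v : R) :
  let psi := fun t : R => inverse_generator phi t%:E in
  archimedean_copula phi D -> differentiable_pos psi ->
  log_concave (fun t => - derive1 psi t) -> v \in `]0, 1[ ->
  {in `]0, 1[ &, {homo (fun u => partial1 D u v) : x y / x <= y}}.
Proof.
move=> psi aD dpsi lc v01 x y x01 y01; rewrite le_eqVlt => /predU1P[->//|xy].
have gphi := archimedean_generator aD.
rewrite (partial1_le_cross aD dpsi x01 y01 v01) mulrC [leRHS]mulrC.
have pos z : z \in `]0, 1[ -> 0 < fine (phi z).
  by rewrite in_itv/= => /andP[]; exact: fine_generator_gt0.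
(* Now [x < y], so [a] is the generator value at [y] and [b] the one at [x]. *)
apply: (log_concave_shift lc); [exact: pos| |exact: pos].
exact: (fine_generator_lt gphi).
Qed.

(** * Schur orders of Archimedean copulas *)

Lemma partial1_schur_le_log_convex (R : realType) (phi1 phi2 : R -> \bar R)
    (D1 D2 : R -> R -> R) :
  let psi1 := fun t : R => inverse_generator phi1 t%:E in
  let psi2 := fun t : R => inverse_generator phi2 t%:E in
  archimedean_copula phi1 D1 -> archimedean_copula phi2 D2 ->
  differentiable_pos psi1 -> differentiable_pos psi2 ->
  log_convex (fun t => - derive1 psi1 t) ->
  log_convex (fun t => - derive1 psi2 t) ->
  partial1_schur_le D1 D2 <-> lower_orthant_le D1 D2.
Proof.
move=> psi1 psi2 aD1 aD2 d1 d2 lc1 lc2.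
have cD1 := archimedean_is_copula aD1; have cD2 := archimedean_is_copula aD2.
rewrite lower_orthant_le_interior//.
have key v : v \in `]0, 1[ ->
    schur_le (fun u => partial1 D1 u v) (fun u => partial1 D2 u v) <->
    (forall u, u \in `]0, 1[ -> D1 u v <= D2 u v).
  move=> v01; have v01' : v \in `[0, 1] by exact: subset_itv_oo_cc v01.
  (* The primitives are the sections at [v], which vanish at 0 and equal [v] at 1. *)
  apply: (@schur_le_nonincreasing _ _ _ (D1 ^~ v) (D2 ^~ v)).
  - exact: partial1_nonincreasing aD1 d1 lc1 v01.
  - exact: partial1_nonincreasing aD2 d2 lc2 v01.
  - exact: partial1_mean_value aD1 d1 v01.
  - exact: partial1_mean_value aD2 d2 v01.
  - by have [] := copula_grounded cD1 v01'.
  - by have [] := copula_grounded cD2 v01'.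
  - by rewrite (copula_margins cD1 v01').2 (copula_margins cD2 v01').2.
by split=> H v v01; apply/key => //; exact: H.
Qed.

Lemma partial1_schur_le_log_concave (R : realType) (phi1 phi2 : R -> \bar R)
    (D1 D2 : R -> R -> R) :
  let psi1 := fun t : R => inverse_generator phi1 t%:E in
  let psi2 := fun t : R => inverse_generator phi2 t%:E in
  archimedean_copula phi1 D1 -> archimedean_copula phi2 D2 ->
  differentiable_pos psi1 -> differentiable_pos psi2 ->
  log_concave (fun t => - derive1 psi1 t) ->
  log_concave (fun t => - derive1 psi2 t) ->
  partial1_schur_le D2 D1 <-> lower_orthant_le D1 D2.
Proof.
move=> psi1 psi2 aD1 aD2 d1 d2 lc1 lc2.
have cD1 := archimedean_is_copula aD1; have cD2 := archimedean_is_copula aD2.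
rewrite lower_orthant_le_interior//.
have key v : v \in `]0, 1[ ->
    schur_le (fun u => partial1 D2 u v) (fun u => partial1 D1 u v) <->
    (forall u, u \in `]0, 1[ -> D1 u v <= D2 u v).
  move=> v01; have v01' : v \in `[0, 1] by exact: subset_itv_oo_cc v01.
  apply: (@schur_le_nondecreasing _ _ _ (D2 ^~ v) (D1 ^~ v)).
  - exact: partial1_nondecreasing aD2 d2 lc2 v01.
  - exact: partial1_nondecreasing aD1 d1 lc1 v01.
  - exact: partial1_mean_value aD2 d2 v01.
  - exact: partial1_mean_value aD1 d1 v01.
  - by have [] := copula_grounded cD2 v01'.
  - by have [] := copula_grounded cD1 v01'.
  - by rewrite (copula_margins cD1 v01').2 (copula_margins cD2 v01').2.
by split=> H v v01; apply/key => //; exact: H.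
Qed.

Lemma lower_orthant_le_swap (R : realType) (D1 D2 : R -> R -> R) :
  lower_orthant_le (fun u v => D1 v u) (fun u v => D2 v u) <->
  lower_orthant_le D1 D2.
Proof. by split=> D12 u v u01 v01; exact: D12. Qed.

Theorem proposition3p3 (R : realType) (phi1 phi2 : R -> \bar R)
    (D1 D2 : R -> R -> R)
    (hD1 : archimedean_copula phi1 D1) (hD2 : archimedean_copula phi2 D2) :
  let psi1 := fun t : R => inverse_generator phi1 t%:E in
  let psi2 := fun t : R => inverse_generator phi2 t%:E in
  [/\ lower_orthant_le D1 D2 <-> subadditive_nneg (phi1 \o psi2),
      differentiable_pos psi1 -> differentiable_pos psi2 ->
      log_convex (fun t => - derive1 psi1 t) ->
      log_convex (fun t => - derive1 psi2 t) ->
      (subadditive_nneg (phi1 \o psi2) <-> partial_schur_le D1 D2) &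
      differentiable_pos psi1 -> differentiable_pos psi2 ->
      log_concave (fun t => - derive1 psi1 t) ->
      log_concave (fun t => - derive1 psi2 t) ->
      (subadditive_nneg (phi1 \o psi2) <-> partial_schur_ge D1 D2)].
Proof.
move=> psi1 psi2; have lo_sub := lower_orthant_le_subadditive hD1 hD2.
have sD1 := archimedean_copula_swap hD1.
have sD2 := archimedean_copula_swap hD2.
split=> // d1 d2 l1 l2; rewrite -lo_sub.
- have H1 := partial1_schur_le_log_convex hD1 hD2 d1 d2 l1 l2.
  (* For the swapped copulas [partial1] unfolds to [partial2] of the original ones. *)
  have H2 := partial1_schur_le_log_convex sD1 sD2 d1 d2 l1 l2.
  rewrite lower_orthant_le_swap in H2.
  split=> [lo|[/H1//]].
  by split; [exact/H1|exact/H2].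
- have H1 := partial1_schur_le_log_concave hD1 hD2 d1 d2 l1 l2.
  have H2 := partial1_schur_le_log_concave sD1 sD2 d1 d2 l1 l2.
  rewrite lower_orthant_le_swap in H2.
  split=> [lo|[/H1//]].
  by split; [exact/H1|exact/H2].
Qed.
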